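(* Let $\alpha\in(0,1)$, let $-\infty\le a<b\le\infty$, and let $f:[0,\infty)\times(a,b)\to\mathbb{R}$ be a continuous function which is locally Lipschitz continuous with respect to the second variable in the following sense: for any $T>0$ and any compact interval $K\subset(a,b)$ there exists a positive constant $L_{K,T}$ such that $$ |f(t,x)-f(t,y)|\le L_{K,T}|x-y|,\quad\forall x,y\in K,\ t\in[0,T]. $$ Consider the equation $$ {}^{C}D^{\alpha}_{0+}x(t)=f(t,x(t)),\quad t>0. $$ Then, for any pair of distinct points $x_1,x_2\in(a,b)$, the solutions $\varphi(\cdot,x_1)$ and $\varphi(\cdot,x_2)$ of this equation starting from $x_1$ and $x_2$, respectively, do not meet; that is, $\varphi(t,x_1)\ne\varphi(t,x_2)$ for every $t$ at which both solutions are defined.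
   Context: For $\alpha\in(0,1)$ the Riemann--Liouville integral is $I^{\alpha}_{0+}x(t)=\frac{1}{\Gamma(\alpha)}\int_0^t(t-\tau)^{\alpha-1}x(\tau)\,d\tau$, the Riemann--Liouville derivative is ${}^{R}D^{\alpha}_{0+}x(t)=\frac{d}{dt}(I^{1-\alpha}_{0+}x)(t)$, and the Caputo derivative is ${}^{C}D^{\alpha}_{0+}x(t)={}^{R}D^{\alpha}_{0+}(x(t)-x(0))$. For $x_i\in(a,b)$, $\varphi(\cdot,x_i)$ denotes the unique continuous solution with $\varphi(0,x_i)=x_i$, with values in $(a,b)$, on its maximal interval of existence $[0,T_b(x_i))$. Equivalently, it satisfies $\varphi(t,x_i)=x_i+\frac{1}{\Gamma(\alpha)}\int_0^t(t-\tau)^{\alpha-1}f(\tau,\varphi(\tau,x_i))\,d\tau$ there. *)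

(* Defs.v *)
From HB Require Import structures.
From mathcomp Require Import all_boot all_order all_algebra.
From mathcomp Require Import all_classical all_reals all_analysis.
Set Implicit Arguments.
Unset Strict Implicit.
Unset Printing Implicit Defensive.
Import Order.TTheory GRing.Theory Num.Theory.
Import numFieldNormedType.Exports.
Local Open Scope classical_set_scope.
Local Open Scope ring_scope.

Section FractionalCalculus.
Context {R : realType}.
Implicit Types (alpha t : R) (x : R -> R).

Definition Gamma alpha : R :=
  \int[lebesgue_measure]_(s in `]0, +oo[) (s `^ (alpha - 1) * expR (- s)).

(* Lebesgue integral; the single point tau = t, where the kernel is singular
   and 0 `^ (alpha - 1) = 0 by convention, is null. *)
Definition RLintegral alpha x t : R :=
  (Gamma alpha)^-1 *
  \int[lebesgue_measure]_(tau in `[0, t]) ((t - tau) `^ (alpha - 1) * x tau).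

(* [derive1] is total: the existence of the derivative is a separate
   condition, [Caputo_derivable]. *)
Definition RLderivative alpha x t : R := derive1 (RLintegral (1 - alpha) x) t.

Definition Caputo alpha x t : R := RLderivative alpha (fun s => x s - x 0) t.

Definition Caputo_derivable alpha x t : Prop :=
  derivable (RLintegral (1 - alpha) (fun s => x s - x 0)) t 1.

Definition oointerval (a b : \bar R) : set R :=
  [set y | (a < y%:E)%E /\ (y%:E < b)%E].

Definition timespan (T : \bar R) : set R :=
  [set t | 0 <= t /\ (t%:E < T)%E].

(* f is only meaningful on [0, +oo[ x ]a, b[; outside it, as phi outside
   [timespan T], takes arbitrary values. *)
Definition continuous_field (a b : \bar R) (f : R -> R -> R) : Prop :=
  {within [set p : R * R | 0 <= p.1 /\ oointerval a b p.2],
    continuous (fun p : R * R => f p.1 p.2)}.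

Definition locally_lipschitz_field (a b : \bar R) (f : R -> R -> R) : Prop :=
  forall (T c d : R), 0 < T -> `[c, d] `<=` oointerval a b ->
  exists2 L : R, 0 < L &
    forall t y z, t \in `[0, T] -> y \in `[c, d] -> z \in `[c, d] ->
      `|f t y - f t z| <= L * `|y - z|.

Definition is_solution alpha (a b : \bar R) (f : R -> R -> R) (x0 : R)
    (T : \bar R) (phi : R -> R) : Prop :=
  [/\ (0 < T)%E,
      phi 0 = x0,
      {within timespan T, continuous phi},
      forall t, timespan T t -> oointerval a b (phi t) &
      forall t, timespan T t -> 0 < t ->
        Caputo_derivable alpha phi t /\ Caputo alpha phi t = f t (phi t)].

Definition is_maximal_solution alpha (a b : \bar R) (f : R -> R -> R) (x0 : R)
    (T : \bar R) (phi : R -> R) : Prop :=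
  is_solution alpha a b f x0 T phi /\
  forall (S : \bar R) (psi : R -> R), is_solution alpha a b f x0 S psi ->
    (T <= S)%E -> (forall t, timespan T t -> psi t = phi t) -> S = T.

End FractionalCalculus.

(* Main.v *)
Require Import Defs.
From mathcomp Require Import all_boot all_order all_algebra.
From mathcomp Require Import all_classical all_reals all_analysis.
From mathcomp Require Import measurable_realfun ring lra.
Set Implicit Arguments.
Unset Strict Implicit.
Unset Printing Implicit Defensive.
Import Order.TTheory GRing.Theory Num.Theory.
Import numFieldNormedType.Exports.
Local Open Scope classical_set_scope.
Local Open Scope ring_scope.

(** Suppose that the two solutions meet, let [T] be their first meeting time and
    say that [phi2 < phi1] on [[0, T[]. Then [u = phi1 - phi2] is nonnegative on
    [[0, T]] and vanishes at [T]. Both solutions being at the same point at time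
    [T], the field takes the same value on them, so that the Caputo derivative
    of [u] at [T] is zero. Nonlocality forbids this: formally, an integration by
    parts turns the Caputo derivative of [u] at [T] into
      [- (u 0 * T^-alpha
          + alpha * int_0^T u(s) (T - s)^(-alpha-1) ds) / Gamma (1 - alpha)],
    which is negative ([caputo_first_meeting]).

    That formula needs [u] to be small near [T] in a quantitative way, whereas
    [u] is only known to be continuous. The rigorous argument works with the
    Abel transform [U(t) = int_0^t (t - s)^-alpha u(s) ds]. Equality of the two
    Caputo derivatives says that [U] has left derivative [u 0 * T^-alpha] at [T],
    hence that [U(T) - U(s) >= c (T - s)] for some [c > 0] and all [s] close to
    [T]. This is impossible ([abel_no_linear_contact]). Integrate it over
    [[S0, T]] against the weight [w(s) = (q - s)^(alpha-2)], where
    [q = T + eta]. By Tonelli, [int w U] is the integral of [u(t)] against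
    [int_t^T w(s) (s - t)^-alpha ds], and this beta-type integral has the
    elementary antiderivative
      [((s - t) / (q - s))^(1-alpha) / ((1 - alpha) (q - t))].
    Its value falls short of [(T - t)^-alpha int w] by at most
    [(T - t)^-alpha eta^alpha / ((1 - alpha) (q - t))]
    ([abel_kernel_average_ge]); therefore [c int w(s) (T - s) ds] is bounded by
    the integral of [u] against this defect ([averaged_increment_le]). The
    defect is an approximate identity at [T]: its mass is bounded uniformly in
    [eta] ([integral_approx_identity_le]) and concentrates at [T], where [u]
    vanishes. So the bound tends to [0] with [eta], while [c int w(s) (T - s) ds]
    stays away from [0]. *)

(** * A fundamental theorem of calculus for singular integrands *)

Section ImproperFTC.
Context {R : realType}.
Notation mu := (@lebesgue_measure R).

(** Both endpoints may be singular, as they are for the power kernels used here.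
    Nonnegativity makes the integrals over an exhaustion of [[a, b]] by compact
    subintervals converge monotonically. *)
Lemma ge0_improper_FTC2 (f F : R -> R) (a b : R) : a < b ->
  (forall x, x \in `]a, b[ -> is_derive x 1 F (f x)) ->
  (forall x, x \in `]a, b[ -> 0 <= f x) ->
  {in `]a, b[, continuous f} ->
  F x @[x --> a^'+] --> F a -> F x @[x --> b^'-] --> F b ->
  (\int[mu]_(x in `[a, b]) (f x)%:E)%E = (F b - F a)%:E.
Proof.
move=> ab dF f0 cf Fa Fb.
have mf : measurable_fun `]a, b[ f.
  by apply: open_continuous_measurable_fun => // x /set_mem; exact: cf.
rewrite (@integral_itv_bndoo _ a b (EFin \o f)); last exact/measurable_EFinP.
pose d n : R := (b - a) / 3 * harmonic n.
have d0 n : 0 < d n by rewrite mulr_gt0 ?divr_gt0 ?subr_gt0// harmonic_gt0.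
have d1 n : d n <= (b - a) / 3.
  apply: ler_piMr; first by rewrite divr_ge0// subr_ge0 ltW.
  by rewrite /harmonic/= invf_le1 ?ltr0n// ler1n.
have d_cvg : d n @[n --> \oo] --> 0.
  by rewrite -(mulr0 ((b - a) / 3)); apply: cvgMl_tmp; exact: cvg_harmonic.
have d_dec m n : (m <= n)%N -> d n <= d m.
  move=> mn; rewrite ler_pM2l ?divr_gt0 ?subr_gt0//.
  by rewrite lef_pV2 ?posrE ?ltr0n// ler_nat.
pose I n := `[a + d n, b - d n]%classic.
have Isub n : I n `<=` `]a, b[.
  move=> x; rewrite /I/= !in_itv/= => /andP[x1 x2].
  by have := d0 n; apply: contraTT; lra.
have IE : \bigcup_n I n = `]a, b[%classic.
  apply/seteqP; split=> [x [n _ /Isub//]|x]; rewrite /I/= in_itv/= => /andP[x1 x2].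
  have m0 : 0 < Num.min (x - a) (b - x) by rewrite lt_min !subr_gt0 x1.
  have [n _ /(_ n (leqnn _))] := cvgr_lt 0 d_cvg _ m0.
  rewrite /= lt_min => /andP[x3 x4].
  by exists n => //=; rewrite in_itv/=; apply/andP; split; lra.
have FTC n : (\int[mu]_(x in I n) (f x)%:E)%E = (F (b - d n) - F (a + d n))%:E.
  have dd : a + d n < b - d n by have := d1 n; lra.
  have dF' x : x \in `[a + d n, b - d n] -> is_derive x 1 F (f x).
    by move=> xI; apply: dF; exact: (Isub n).
  have cF : {within `[a + d n, b - d n], continuous F}.
    by apply: derivable_within_continuous => x /dF' [].
  rewrite (@continuous_FTC2 _ f F _ _ dd).
  - by rewrite EFinB.
  - apply: continuous_in_subspaceT => x /set_mem xI; apply: cf.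
    exact: (Isub n).
  - have /(continuous_within_itvP _ dd)[_ ? ?] := cF; split => // x xI.
    by have [] := dF' x (subset_itv_oo_cc xI).
  - by move=> x xI; have [? <-] := dF' x (subset_itv_oo_cc xI); rewrite derive1E.
have cvg1 : (\int[mu]_(x in I n) (f x)%:E)%E @[n --> \oo] -->
    (\int[mu]_(x in `]a, b[) (f x)%:E)%E.
  rewrite -IE; apply: ge0_nondecreasing_set_cvg_integral.
  - move=> m n mn; rewrite subsetEset => x; rewrite /I/= !in_itv/=.
    by have := d_dec m n mn => ? /andP[x1 x2]; apply/andP; split; lra.
  - by move=> n; exact: measurable_itv.
  - move=> n; apply/measurable_EFinP; apply: measurable_funS mf => //.
  - by move=> n x xI; rewrite lee_fin f0//; exact: (Isub n).
have cvg2 : (\int[mu]_(x in I n) (f x)%:E)%E @[n --> \oo] --> (F b - F a)%:E.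
  under eq_cvg do rewrite FTC.
  apply: cvg_EFin; first exact: nearW.
  apply: cvgB.
  - move/cvg_at_leftP : Fb; apply; split=> [n|]; first by have := d0 n; lra.
    by rewrite -[X in _ --> X]subr0; apply: cvgB => //; exact: cvg_cst.
  - move/cvg_at_rightP : Fa; apply; split=> [n|]; first by have := d0 n; lra.
    by rewrite -[X in _ --> X]addr0; apply: cvgD => //; exact: cvg_cst.
exact: cvg_unique cvg1 cvg2.
Qed.

End ImproperFTC.

(** * Power functions and their integrals *)

Section PowerFunctions.
Context {R : realType}.
Notation mu := (@lebesgue_measure R).
Implicit Types (p x y q alpha : R).

Lemma is_derive_powR_comp (g : R -> R) p x dg : 0 < g x ->
  is_derive x 1 g dg ->
  is_derive x 1 (fun y => g y `^ p) (p * g x `^ (p - 1) * dg).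
Proof.
move=> gx0 dgx.
have := @is_derive1_comp _ (fun y => y `^ p) g x _ _ (is_derive1_powR p gx0) dgx.
by rewrite mulrC => H; apply: is_derive_eq; rewrite mulrC.
Qed.

Lemma powR_continuous_gt0 p x : 0 < x -> {for x, continuous (fun y => y `^ p)}.
Proof.
move=> x0; apply/differentiable_continuous/derivable1_diffP.
by have [] := is_derive1_powR p x0.
Qed.

Lemma cvg_powR_gt0 {T : Type} {F : set_system T} {FF : Filter F} (g : T -> R) p (l : R) :
  0 < l -> g x @[x --> F] --> l -> g x `^ p @[x --> F] --> l `^ p.
Proof.
move=> l0 gl; have := @powR_continuous_gt0 p l l0; rewrite /prop_for/continuous_at => pl.
exact: cvg_comp gl pl.
Qed.

(** Positivity of [g] is needed because a negative base has power [1] whatever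
    the exponent. *)
Lemma cvg_powR_0 {T : Type} {F : set_system T} {FF : Filter F} (g : T -> R) p :
  0 < p -> (\forall x \near F, 0 < g x) -> g x @[x --> F] --> 0 ->
  g x `^ p @[x --> F] --> 0 `^ p.
Proof.
move=> p0 g0 gl; rewrite powR0 ?gt_eqF//.
suff g0' : g x @[x --> F] --> 0^'+ by exact: cvg_comp g0' (powR_cvg0 p0).
move=> P; rewrite /at_right/within/= => HP.
have := gl _ HP; rewrite /= nbhs_filterE => HP'.
by near=> x; apply: (near HP' x) => //; near: x.
Unshelve. all: end_near. Qed.

Lemma integral_abel_kernel alpha (a b : R) : alpha < 1 -> a < b ->
  (\int[mu]_(x in `[a, b]) ((b - x) `^ (- alpha))%:E)%E =
  ((b - a) `^ (1 - alpha) / (1 - alpha))%:E.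
Proof.
move=> a1 ab; have p0 : 0 < 1 - alpha by rewrite subr_gt0.
pose F x := - ((b - x) `^ (1 - alpha) / (1 - alpha)).
have Fb : F b = 0 by rewrite /F subrr powR0 ?gt_eqF// mul0r oppr0.
transitivity ((F b - F a)%:E); last by rewrite Fb /F sub0r opprK.
apply: (ge0_improper_FTC2 ab).
- move=> x; rewrite in_itv/= => /andP[x1 x2].
  have bx : 0 < b - x by rewrite subr_gt0.
  have d1 : is_derive x 1 (fun y => b - y) (- 1 : R).
    by apply: is_derive_eq; rewrite add0r mul1r.
  have := @is_derive_powR_comp (fun y => b - y) (1 - alpha) x _ bx d1 => d2.
  rewrite /F; apply: is_derive_eq.
  rewrite scaler0 add0r (_ : 1 - alpha - 1 = - alpha); last by ring.
  by rewrite /GRing.scale/= mulrN1 mulrN opprK mulrA mulVf ?mul1r ?gt_eqF.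
- by move=> x _; exact: powR_ge0.
- move=> x; rewrite in_itv/= => /andP[x1 x2].
  apply: cvg_powR_gt0; first by rewrite subr_gt0.
  by apply: cvgB; [exact: cvg_cst|exact: cvg_id].
- apply: cvgN; apply: cvgMr_tmp; apply: cvg_powR_gt0; first by rewrite subr_gt0.
  apply: cvgB; [exact: cvg_cst|]. apply: cvg_at_right_filter; exact: cvg_id.
- apply: cvgN; apply: cvgMr_tmp; rewrite subrr; apply: cvg_powR_0 => //.
  + near=> x; rewrite subr_gt0; near: x; exact: nbhs_left_lt.
  + rewrite -(subrr b); apply: cvgB; [exact: cvg_cst|].
    by apply: cvg_at_left_filter; exact: cvg_id.
Unshelve. all: end_near. Qed.


Lemma is_derive_moebius (a q x : R) : x < q ->
  is_derive x 1 (fun s => (s - a) / (q - s)) ((q - a) / (q - x) ^+ 2).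
Proof.
move=> xq; have qx : q - x != 0 by rewrite subr_eq0 gt_eqF.
have d1 : is_derive x 1 (fun y => q - y) (- 1 : R).
  by apply: is_derive_eq; rewrite add0r mul1r.
have d2 := @is_deriveV _ (fun y => q - y) x (- 1) 1 qx d1.
apply: is_derive_eq.
rewrite /GRing.scale/=; field; exact: qx.
Qed.


Lemma cvg_subr_r (F : set_system R) {FF : Filter F} (b l : R) :
  x @[x --> F] --> l -> b - x @[x --> F] --> b - l.
Proof. by move=> Fl; apply: cvgB => //; exact: cvg_cst. Qed.

Lemma cvg_moebius (F : set_system R) {FF : Filter F} (a q l : R) : l < q ->
  x @[x --> F] --> l -> (x - a) / (q - x) @[x --> F] --> (l - a) / (q - l).
Proof.
move=> lq Fl; apply: cvgM; first by apply: cvgB => //; exact: cvg_cst.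
by apply: cvgV; [rewrite subr_eq0 gt_eqF|exact: cvg_subr_r].
Qed.

Lemma integral_shifted_power alpha (a b q : R) : alpha < 1 -> a < b -> b < q ->
  (\int[mu]_(x in `[a, b]) ((q - x) `^ (alpha - 2))%:E)%E =
  (((q - b) `^ (alpha - 1) - (q - a) `^ (alpha - 1)) / (1 - alpha))%:E.
Proof.
move=> a1 ab bq; have p0 : 0 < 1 - alpha by rewrite subr_gt0.
pose F x := (q - x) `^ (alpha - 1) / (1 - alpha).
transitivity ((F b - F a)%:E); last by rewrite /F mulrBl.
have cF x : x < q -> is_derive x 1 F ((q - x) `^ (alpha - 2)).
  move=> xq; have qx : 0 < q - x by rewrite subr_gt0.
  have d1 : is_derive x 1 (fun y => q - y) (- 1 : R).
    by apply: is_derive_eq; rewrite add0r mul1r.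
  have d2 := @is_derive_powR_comp (fun y => q - y) (alpha - 1) x _ qx d1.
  rewrite /F; apply: is_derive_eq.
  rewrite scaler0 add0r (_ : alpha - 1 - 1 = alpha - 2); last by ring.
  rewrite /GRing.scale/=; field; lra.
have FF x : x < q -> {for x, continuous F}.
  by move=> /cF[dF _]; apply/differentiable_continuous/derivable1_diffP.
apply: (ge0_improper_FTC2 ab).
- by move=> x; rewrite in_itv/= => /andP[x1 x2]; apply: cF; lra.
- by move=> x _; exact: powR_ge0.
- move=> x; rewrite in_itv/= => /andP[x1 x2].
  by apply: cvg_powR_gt0; [lra|apply: cvg_subr_r; exact: cvg_id].
- by apply: cvg_at_right_filter; apply: FF; lra.
- by apply: cvg_at_left_filter; exact: FF.
Qed.

(** This is the beta integral of [(s - t)^-alpha * (q - s)^(alpha-2)]: the total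
    exponent [-2] makes it elementary, the Moebius map [(s - t) / (q - s)] having
    derivative [(q - t) / (q - s)^2]. *)
Lemma integral_beta_kernel alpha (t b q : R) : alpha < 1 -> t < b -> b < q ->
  (\int[mu]_(s in `[t, b])
     (((s - t) / (q - s)) `^ (- alpha) / (q - s) ^+ 2)%:E)%E =
  (((b - t) / (q - b)) `^ (1 - alpha) / ((1 - alpha) * (q - t)))%:E.
Proof.
move=> a1 tb bq; have p0 : 0 < 1 - alpha by rewrite subr_gt0.
pose F s := ((s - t) / (q - s)) `^ (1 - alpha) / ((1 - alpha) * (q - t)).
transitivity ((F b - F t)%:E).
  apply: (ge0_improper_FTC2 tb).
  - move=> x; rewrite in_itv/= => /andP[x1 x2].
    have xq : x < q by lra.
    have gx : 0 < (x - t) / (q - x) by rewrite divr_gt0 ?subr_gt0.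
    have d1 := is_derive_moebius t xq.
    have d2 := @is_derive_powR_comp (fun y => (y - t) / (q - y)) (1 - alpha) x _ gx d1.
    rewrite /F; apply: is_derive_eq.
    rewrite scaler0 add0r (_ : 1 - alpha - 1 = - alpha); last by ring.
    rewrite /GRing.scale/=; field; lra.
  - by move=> x _; rewrite divr_ge0 ?powR_ge0 ?sqr_ge0.
  - move=> x; rewrite in_itv/= => /andP[x1 x2].
    have xq : x < q by lra.
    apply: cvgM.
      by apply: cvg_powR_gt0; [rewrite divr_gt0; lra|apply: cvg_moebius; [|exact: cvg_id]].
    apply: cvgV; first by rewrite expf_neq0// subr_eq0 gt_eqF.
    by apply: cvgM; apply: cvg_subr_r; exact: cvg_id.
  - apply: cvgMr_tmp; rewrite subrr mul0r; apply: cvg_powR_0 => //.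
    + near=> x; rewrite divr_gt0 ?subr_gt0//; near: x.
      by apply: nbhs_right_lt; lra.
    + rewrite -(mul0r (q - t)^-1) -[X in X / _](subrr t).
      by apply: cvg_moebius; [lra|apply: cvg_at_right_filter; exact: cvg_id].
  - apply: cvgMr_tmp; apply: cvg_powR_gt0; first by rewrite divr_gt0 ?subr_gt0.
    by apply: cvg_moebius => //; apply: cvg_at_left_filter; exact: cvg_id.
by rewrite /F subrr mul0r powR0 ?gt_eqF// mul0r subr0.
Unshelve. all: end_near. Qed.

End PowerFunctions.

(** * The approximate identity *)

Section ApproximateIdentity.
Context {R : realType}.
Notation mu := (@lebesgue_measure R).
Implicit Types (p x y q alpha : R).

(** The right-hand side is a derivative, which the left-hand side is not in
    elementary terms. In the barycentric coordinates [y = (b - x) / (q - x)] and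
    [z = (q - b) / (q - x)], with [y + z = 1], the claim reduces to
    [1 <= y^alpha + z^(1-alpha)], which holds since both powers exceed their
    bases. *)
Lemma approx_identity_majorant alpha (x b q : R) :
  0 < alpha -> alpha < 1 -> x < b -> b < q ->
  (b - x) `^ (- alpha) * ((q - b) `^ alpha / (q - x)) <=
  (q - b) `^ alpha * (q - x) `^ (- alpha - 1) +
  ((b - x) / (q - x)) `^ (- alpha) * ((q - b) / (q - x) ^+ 2).
Proof.
move=> a0 a1 xb bq.
have [r0 e0 s0] : [/\ 0 < b - x, 0 < q - b & 0 < q - x] by split; lra.
pose y := (b - x) / (q - x); pose z := (q - b) / (q - x).
have y0 : 0 < y by rewrite divr_gt0.
have z0 : 0 < z by rewrite divr_gt0.
have yz : y + z = 1 by rewrite /y /z; field; lra.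
have rE : b - x = y * (q - x) by rewrite /y; field; lra.
have eE : q - b = z * (q - x) by rewrite /z; field; lra.
have -> : (q - b) / (q - x) ^+ 2 = z / (q - x) by rewrite /z; field; lra.
rewrite -/y; clearbody y z.
rewrite rE eE !powRM ?(ltW y0) ?(ltW z0) ?(ltW s0)//.
have -> : (q - x) `^ (- alpha - 1) = (q - x) `^ (- alpha) / (q - x).
  by rewrite powRB ?(gt_eqF s0) ?implybT// powRr1// ltW.
have sE : (q - x) `^ alpha * (q - x) `^ (- alpha) = 1.
  by rewrite powRN mulfV// gt_eqF// powR_gt0.
have -> : y `^ (- alpha) * (q - x) `^ (- alpha) * (z `^ alpha * (q - x) `^ alpha / (q - x))
  = y `^ (- alpha) * z `^ alpha * ((q - x) `^ alpha * (q - x) `^ (- alpha)) / (q - x) by ring.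
have -> : z `^ alpha * (q - x) `^ alpha * ((q - x) `^ (- alpha) / (q - x)) =
  z `^ alpha * ((q - x) `^ alpha * (q - x) `^ (- alpha)) / (q - x) by ring.
rewrite sE !mulr1 mulrA -mulrDl ler_pM2r ?invr_gt0//.
have yE : y `^ alpha * y `^ (- alpha) = 1.
  by rewrite powRN mulfV// gt_eqF// powR_gt0.
have y1 : y <= y `^ alpha by apply: ger1_powR; [lra|exact: ltW].
have z1 : z `^ alpha <= 1.
  by rewrite -(powRr0 z); apply: ger_powR; [lra|exact: ltW].
have w0 : 0 < y `^ (- alpha) by exact: powR_gt0.
have za0 : 0 < z `^ alpha by exact: powR_gt0.
have zE : z `^ alpha = y `^ (- alpha) * (z `^ alpha * y `^ alpha).
  by transitivity (z `^ alpha * (y `^ alpha * y `^ (- alpha)));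
    [rewrite yE mulr1|ring].
rewrite [X in _ <= X + _]zE -mulrDr ler_pM2l//.
have {1}-> : z `^ alpha = z `^ alpha * y + z `^ alpha * z.
  by rewrite -mulrDr yz mulr1.
apply: lerD; first by rewrite ler_pM2l.
by rewrite ler_piMl// ltW.
Qed.

(** The bound does not depend on [q]: this is what lets [q] tend to [b] while the
    mass of the kernel stays under control. *)
Lemma integral_approx_identity_le alpha (a b q : R) :
  0 < alpha -> alpha < 1 -> a < b -> b < q ->
  (\int[mu]_(x in `[a, b])
     ((b - x) `^ (- alpha) * ((q - b) `^ alpha / (q - x)))%:E <=
   (alpha^-1 + (1 - alpha)^-1)%:E)%E.
Proof.
move=> a0 a1 ab bq; have p0 : 0 < 1 - alpha by rewrite subr_gt0.
pose f x := (q - b) `^ alpha * (q - x) `^ (- alpha - 1) +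
  ((b - x) / (q - x)) `^ (- alpha) * ((q - b) / (q - x) ^+ 2).
pose F x := (q - b) `^ alpha * ((q - x) `^ (- alpha) / alpha)
  - ((b - x) / (q - x)) `^ (1 - alpha) / (1 - alpha).
have hE x : (b - x) / (q - x) = - ((x - b) / (q - x)).
  by rewrite -mulNr opprB.
have cf : {in `]a, b[, continuous f}.
  move=> x; rewrite in_itv/= => /andP[x1 x2].
  have xq : x < q by lra.
  apply: cvgD.
    apply: cvgMl_tmp; apply: cvg_powR_gt0; first by rewrite subr_gt0.
    exact: cvg_subr_r.
  apply: cvgM.
    apply: cvg_powR_gt0; first by rewrite divr_gt0 ?subr_gt0.
    under eq_fun do rewrite hE.
    by rewrite hE; apply: cvgN; apply: cvg_moebius.
  apply: cvgMl_tmp; apply: cvgV; first by rewrite expf_neq0// subr_eq0 gt_eqF.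
  by apply: cvgM; apply: cvg_subr_r; exact: cvg_id.
have f0 x : x \in `]a, b[ -> 0 <= f x.
  move=> _; rewrite /f addr_ge0// mulr_ge0 ?powR_ge0// divr_ge0 ?sqr_ge0//.
  lra.
have fI : (\int[mu]_(x in `[a, b]) (f x)%:E)%E = (F b - F a)%:E.
  apply: (ge0_improper_FTC2 ab) => //.
  - move=> x; rewrite in_itv/= => /andP[x1 x2].
    have xq : x < q by lra.
    have qx : 0 < q - x by lra.
    have gx : 0 < - ((x - b) / (q - x)) by rewrite -hE divr_gt0 ?subr_gt0.
    have d1 : is_derive x 1 (fun y => q - y) (- 1 : R).
      by apply: is_derive_eq; rewrite add0r mul1r.
    have d2 := @is_derive_powR_comp _ (fun y => q - y) (- alpha) x _ qx d1.
    have d3 := is_derive_moebius b xq.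
    have d4 : is_derive x 1 (fun y => - ((y - b) / (q - y))) _ := is_deriveN d3.
    have d5 := @is_derive_powR_comp _ (fun y => - ((y - b) / (q - y))) (1 - alpha) x _ gx d4.
    have -> : F = (fun x => (q - b) `^ alpha * ((q - x) `^ (- alpha) / alpha)
      - (- ((x - b) / (q - x))) `^ (1 - alpha) / (1 - alpha)).
      by apply/funext => z; rewrite /F hE.
    apply: is_derive_eq.
    rewrite !scaler0 !add0r (_ : 1 - alpha - 1 = - alpha); last by ring.
    rewrite /f -hE /GRing.scale/=; field; lra.
  - apply: cvgB.
      apply: cvgMl_tmp; apply: cvgMr_tmp; apply: cvg_powR_gt0; first by lra.
      by apply: cvg_subr_r; apply: cvg_at_right_filter; exact: cvg_id.
    apply: cvgMr_tmp; apply: cvg_powR_gt0; first by rewrite divr_gt0 ?subr_gt0; lra.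
    under eq_fun do rewrite hE.
    rewrite hE; apply: cvgN; apply: cvg_moebius; first lra.
    by apply: cvg_at_right_filter; exact: cvg_id.
  - apply: cvgB.
      apply: cvgMl_tmp; apply: cvgMr_tmp; apply: cvg_powR_gt0; first by lra.
      by apply: cvg_subr_r; apply: cvg_at_left_filter; exact: cvg_id.
    apply: cvgMr_tmp; rewrite subrr mul0r; apply: cvg_powR_0 => //.
    + near=> x; rewrite divr_gt0 ?subr_gt0//.
      by apply: (@lt_trans _ _ b).
    + under eq_fun do rewrite hE.
      rewrite -oppr0 -[X in - X](mul0r (q - b)^-1) -[X in X / _](subrr b).
      apply: cvgN; apply: cvg_moebius => //.
      by apply: cvg_at_left_filter; exact: cvg_id.
have mf : measurable_fun `[a, b] f.
  apply: (@measurable_fun_itv_cc _ _ _ false true).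
  by apply: open_continuous_measurable_fun => // x /set_mem; exact: cf.
apply: (@le_trans _ _ (\int[mu]_(x in `[a, b]) (f x)%:E)%E).
  apply: ge0_le_integral => //.
  - move=> x; rewrite /= in_itv/= => /andP[x1 x2].
    by rewrite lee_fin mulr_ge0 ?powR_ge0// divr_ge0 ?powR_ge0//; lra.
  - apply/measurable_EFinP; apply: (@measurable_fun_itv_cc _ _ _ false true).
    apply: open_continuous_measurable_fun => // x /set_mem.
    rewrite /= in_itv/= => /andP[x1 x2]; apply: cvgM.
      apply: cvg_powR_gt0; first by rewrite subr_gt0.
      exact: cvg_subr_r.
    apply: cvgMl_tmp; apply: cvgV; last by apply: cvg_subr_r; exact: cvg_id.
    by rewrite gt_eqF; lra.
  - exact/measurable_EFinP.
  - move=> x; rewrite /= in_itv/= => /andP[x1 x2]; rewrite lee_fin.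
    have [->|xb] := eqVneq x b; last by apply: approx_identity_majorant; lra.
    rewrite subrr powR0 ?mul0r ?oppr_eq0 ?gt_eqF// addr_ge0//.
      by rewrite mulr_ge0 ?powR_ge0.
    by rewrite mulr_ge0 ?powR_ge0// divr_ge0 ?sqr_ge0//; lra.
rewrite fI lee_fin /F subrr mul0r powR0 ?gt_eqF// mul0r subr0.
have qb : q - b != 0 by rewrite gt_eqF; lra.
rewrite mulrA -powRD ?qb ?implybT// subrr powRr0 mul1r opprB lerD2l.
apply: (@le_trans _ _ (((b - a) / (q - a)) `^ (1 - alpha) / (1 - alpha))).
  rewrite gerBl mulr_ge0 ?powR_ge0// divr_ge0 ?powR_ge0//; exact: ltW.
rewrite ler_piMl ?invr_ge0 ?(ltW p0)//.
rewrite -[leRHS](powRr0 ((b - a) / (q - a))); apply: ger_powR; last exact: ltW.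
have qa : 0 < q - a by lra.
by apply/andP; split; [rewrite divr_gt0//; lra|rewrite ler_pdivrMr//; lra].
Unshelve. all: end_near. Qed.

End ApproximateIdentity.

(** * Exchange of integrals over sets *)

Section Tonelli.
Context {R : realType}.
Notation mu := (@lebesgue_measure R).

Lemma measurable_partial_integral (B : set R) (h : R * R -> R) :
  measurable B -> measurable_fun setT h -> (forall z, 0 <= h z) ->
  measurable_fun setT (fun x => (\int[mu]_(y in B) (h (x, y))%:E)%E).
Proof.
move=> mB mh h0.
pose g (z : R * R) := (h z * \1_B z.2)%:E.
have -> : (fun x => (\int[mu]_(y in B) (h (x, y))%:E)%E) = fubini_F mu g.
  apply/funext => x; rewrite /fubini_F [LHS]integral_mkcond; apply: eq_integral => y _.
  by rewrite patchE /g indicE/=; case: (y \in B); rewrite ?mulr1 ?mulr0.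
apply: measurable_fun_fubini_tonelli_F.
  apply/measurable_EFinP; apply: measurable_funM => //.
  by apply: measurableT_comp => //; exact: measurable_indic.
by move=> z; rewrite lee_fin mulr_ge0// indicE.
Qed.

Lemma tonelli_set (A B : set R) (h : R * R -> R) :
  measurable A -> measurable B -> measurable_fun setT h -> (forall z, 0 <= h z) ->
  (\int[mu]_(x in A) \int[mu]_(y in B) (h (x, y))%:E =
   \int[mu]_(y in B) \int[mu]_(x in A) (h (x, y))%:E)%E.
Proof.
move=> mA mB mh h0.
pose g (z : R * R) := (h z * (\1_A z.1 * \1_B z.2))%:E.
have gA x : ((fun x => \int[mu]_(y in B) (h (x, y))%:E) \_ A)%E x =
    (\int[mu]_y g (x, y))%E.
  rewrite patchE; case: ifPn => xA.
    rewrite [LHS]integral_mkcond; apply: eq_integral => y _.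
    rewrite patchE /g !indicE/= xA mul1r.
    by case: (y \in B); rewrite ?mulr1 ?mulr0.
  rewrite integral0_eq// => y _.
  by rewrite /g !indicE/= (negbTE xA) mul0r mulr0.
have gB y : ((fun y => \int[mu]_(x in A) (h (x, y))%:E) \_ B)%E y =
    (\int[mu]_x g (x, y))%E.
  rewrite patchE; case: ifPn => yB.
    rewrite [LHS]integral_mkcond; apply: eq_integral => x _.
    rewrite patchE /g !indicE/= yB mulr1.
    by case: (x \in A); rewrite ?mulr1 ?mulr0.
  rewrite integral0_eq// => x _.
  by rewrite /g !indicE/= (negbTE yB) !mulr0.
rewrite integral_mkcond [RHS]integral_mkcond.
under eq_integral do rewrite gA.
under [RHS]eq_integral do rewrite gB.
apply: fubini_tonelli.
  apply/measurable_EFinP; apply: measurable_funM => //.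
  by apply: measurable_funM; apply: measurableT_comp => //; exact: measurable_indic.
by move=> z; rewrite lee_fin mulr_ge0// mulr_ge0// indicE.
Qed.

End Tonelli.

(** * The Abel kernel and its weighted averages *)

Section AbelKernel.
Context {R : realType}.
Notation mu := (@lebesgue_measure R).
Implicit Types (alpha x : R).

(** The truncation at [0] makes the kernel vanish on the nonpositive reals (a
    power of a negative base would be [1]), so that an integral over [[0, s]]
    against it may be written over any larger segment. *)
Definition abel_kernel alpha x : R := Num.max x 0 `^ (- alpha).

Lemma abel_kernel_ge0 alpha x : 0 <= abel_kernel alpha x.
Proof. exact: powR_ge0. Qed.

Lemma abel_kernelE alpha x : 0 < alpha -> 0 <= x ->
  abel_kernel alpha x = x `^ (- alpha).
Proof. by move=> a0 x0; rewrite /abel_kernel max_l. Qed.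

Lemma abel_kernel_le0 alpha x : 0 < alpha -> x <= 0 -> abel_kernel alpha x = 0.
Proof.
by move=> a0 x0; rewrite /abel_kernel max_r// powR0// oppr_eq0 gt_eqF.
Qed.

Lemma measurable_abel_kernel alpha : measurable_fun setT (abel_kernel alpha).
Proof.
apply: (measurableT_comp (measurable_powR _)).
by apply: measurable_maxr => //; exact: measurable_cst.
Qed.

Lemma ler_powRN p (x y : R) : 0 <= p -> 0 < x -> x <= y ->
  y `^ (- p) <= x `^ (- p) :> R.
Proof.
move=> p0 x0 xy; have y0 : 0 < y by exact: lt_le_trans xy.
rewrite !powRN lef_pV2 ?posrE ?powR_gt0//.
by apply: ge0_ler_powR; rewrite ?nnegrE// ltW.
Qed.

(** The first factor on the left is the integral of the weight
    [(q - s)^(alpha-2)] over [[S0, T]]. For [t < S0] the kernel at [s - t] is at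
    least its value at [T - t], so averaging loses nothing. For [t] in
    [[S0, T]] the average is the beta integral, and the defect comes from
    [1 = (T - t) / (q - t) + (q - T) / (q - t)]. *)
Lemma abel_kernel_average_ge alpha (S0 T q t : R) :
  0 < alpha -> alpha < 1 -> S0 < T -> T < q ->
  ((((q - T) `^ (alpha - 1) - (q - S0) `^ (alpha - 1)) / (1 - alpha) *
     abel_kernel alpha (T - t))%:E <=
   \int[mu]_(s in `[S0, T]) ((q - s) `^ (alpha - 2) * abel_kernel alpha (s - t))%:E +
   (((fun t => (1 - alpha)^-1 * ((T - t) `^ (- alpha) * ((q - T) `^ alpha / (q - t))))
     \_ `[S0, T]) t)%:E)%E.
Proof.
move=> a0 a1 ST Tq; have p0 : 0 < 1 - alpha by lra.
set e := (X in (_ + ((X \_ _) t)%:E)%E).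
set h := fun s => (q - s) `^ (alpha - 2) * abel_kernel alpha (s - t).
have h0 s : 0 <= h s by rewrite mulr_ge0 ?powR_ge0.
have mw : measurable_fun setT (fun s : R => (q - s) `^ (alpha - 2)).
  apply: (measurableT_comp (measurable_powR _)).
  by apply: measurable_funB => //; exact: measurable_cst.
have mh : measurable_fun setT h.
  apply: measurable_funM => //; apply: (measurableT_comp (measurable_abel_kernel _)).
  by apply: measurable_funB => //; exact: measurable_cst.
have e0 : 0 <= (e \_ `[S0, T]) t.
  rewrite patchE; case: ifPn => // /set_mem; rewrite /= in_itv/= => /andP[t1 t2].
  by rewrite mulr_ge0 ?invr_ge0 ?(ltW p0)// mulr_ge0 ?powR_ge0// divr_ge0 ?powR_ge0//; lra.
have [Tt|tT] := leP T t.
  rewrite abel_kernel_le0// ?subr_le0// mulr0.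
  apply: adde_ge0; last by rewrite lee_fin.
  by apply: integral_ge0 => s _; rewrite lee_fin; exact: h0.
have [tS|St] := ltP t S0.
  rewrite -[leLHS]adde0; apply: leeD; last by rewrite lee_fin.
  rewrite mulrC EFinM -integral_shifted_power// -ge0_integralZl_EFin//.
  - apply: ge0_le_integral => //.
    + by move=> s _; rewrite lee_fin mulr_ge0 ?powR_ge0.
    + by apply/measurable_EFinP; apply: measurable_funTS; apply: measurable_funM.
    + by apply/measurable_EFinP; apply: measurable_funTS; exact: mh.
    + move=> s; rewrite /= in_itv/= => /andP[s1 s2].
      rewrite lee_fin mulrC ler_wpM2l ?powR_ge0//.
      by rewrite !abel_kernelE//; [apply: ler_powRN; lra|lra|lra].
  - by move=> s _; rewrite lee_fin powR_ge0.
  - by apply/measurable_EFinP; exact: measurable_funTS.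
  - exact: powR_ge0.
rewrite {1}/abel_kernel max_l; last by lra.
rewrite patchE mem_set; last by rewrite /= in_itv/= St ltW.
apply: (@le_trans _ _ (\int[mu]_(s in `[t, T]) (h s)%:E + (e t)%:E)%E); last first.
  apply: leeD => //; apply: ge0_subset_integral => //.
  - by apply: measurable_funTS; apply/measurable_EFinP; exact: mh.
  - by move=> s _; rewrite lee_fin; exact: h0.
  - by move=> s /=; rewrite !in_itv/= => /andP[s1 ->]; rewrite (le_trans St).
have -> : (\int[mu]_(s in `[t, T]) (h s)%:E)%E =
    (((T - t) / (q - T)) `^ (1 - alpha) / ((1 - alpha) * (q - t)))%:E.
  rewrite -integral_beta_kernel//; apply: eq_integral => s /set_mem.
  rewrite /= in_itv/= => /andP[s1 s2]; congr EFin.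
  rewrite /h abel_kernelE ?subr_ge0//.
  have qs : 0 < q - s by lra.
  rewrite powRM ?subr_ge0 ?invr_ge0 ?(ltW qs)// -(powR_inv1 (ltW qs)) -powRrM.
  rewrite mulN1r opprK powRB ?(gt_eqF qs) ?implybT//.
  by rewrite powR_mulrn ?(ltW qs)// mulrC mulrA.
rewrite -EFinD lee_fin /e.
have r0 : 0 < T - t by lra.
have n0 : 0 < q - T by lra.
have s0 : 0 < q - t by lra.
apply: (@le_trans _ _ ((q - T) `^ (alpha - 1) / (1 - alpha) * (T - t) `^ (- alpha))).
  rewrite ler_wpM2r ?powR_ge0// ler_pM2r ?invr_gt0//.
  by rewrite gerBl powR_ge0.
have -> : ((T - t) / (q - T)) `^ (1 - alpha) =
    (T - t) * (T - t) `^ (- alpha) * (q - T) `^ (alpha - 1).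
  rewrite powRM ?invr_ge0 ?(ltW r0) ?(ltW n0)// -(powR_inv1 (ltW n0)) -powRrM.
  rewrite mulN1r opprB; congr (_ * _).
  by rewrite powRD ?(gt_eqF r0) ?implybT// powRr1// ltW.
have -> : (q - T) `^ alpha = (q - T) * (q - T) `^ (alpha - 1).
  rewrite -[X in X * _ ](powRr1 (ltW n0)) -powRD ?(gt_eqF n0) ?implybT//.
  by congr powR; ring.
move: (powR _ _) (powR _ _) => K N.
rewrite le_eqVlt; apply/orP; left; apply/eqP.
field; lra.
Qed.

End AbelKernel.

(** * Averaging the increments of an Abel transform *)

Section Averaging.
Context {R : realType}.
Notation mu := (@lebesgue_measure R).
Context (alpha T : R) (u : R -> R) (u0 : forall t, 0 <= u t).

(** The domain is independent of [s], as an exchange of integrals requires; the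
    kernel itself cuts the integral off at [s]. *)
Definition abel_integral (s : R) : \bar R :=
  (\int[mu]_(t in `[0%R, T]) (abel_kernel alpha (s - t) * u t)%:E)%E.

Lemma abel_integral_ge0 s : (0 <= abel_integral s)%E.
Proof.
by apply: integral_ge0 => t _; rewrite lee_fin mulr_ge0 ?abel_kernel_ge0.
Qed.

(** Integrating the assumed increments against the weight bounds
    [int w U + c int w(s) (T - s)] by [(int w) U(T)], while exchanging the
    integrals and comparing kernels bounds [(int w) U(T)] by [int w U] plus the
    integral of [u] against the defect. Cancelling the finite [int w U] leaves
    the defect alone, which the affine majorant of [u] splits into its mass
    times [eps] and a term of size [(q - T)^alpha]. *)
Lemma averaged_increment_le (S0 q c eps C : R) :
  0 < alpha -> alpha < 1 -> continuous u -> 0 <= S0 -> S0 < T -> T < q -> 0 <= c -> 0 <= eps -> 0 <= C ->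
  (forall t, t \in `[S0, T] -> u t <= eps + C * (T - t)) ->
  (abel_integral T < +oo)%E ->
  (forall s, s \in `[S0, T] ->
    (abel_integral s + (c * (T - s))%:E <= abel_integral T)%E) ->
  (\int[mu]_(s in `[S0, T]) ((q - s) `^ (alpha - 2) * (c * (T - s)))%:E <=
   ((1 - alpha)^-1 * (eps * (alpha^-1 + (1 - alpha)^-1) +
     C * (q - T) `^ alpha * ((T - S0) `^ (1 - alpha) / (1 - alpha))))%:E)%E.
Proof.
move=> a0 a1 cu S00 ST Tq c0 eps0 C0 uC UT Uinc; have p0 : 0 < 1 - alpha by lra.
have mu_ : measurable_fun setT u by exact: continuous_measurable_fun.
pose w s : R := (q - s) `^ (alpha - 2).
pose k := abel_kernel alpha.
pose M := ((q - T) `^ (alpha - 1) - (q - S0) `^ (alpha - 1)) / (1 - alpha).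
pose err t := (1 - alpha)^-1 * ((T - t) `^ (- alpha) * ((q - T) `^ alpha / (q - t))).
pose h (z : R * R) := w z.1 * (k (z.1 - z.2) * u z.2).
have w0 s : 0 <= w s by exact: powR_ge0.
have k0 s : 0 <= k s by exact: abel_kernel_ge0.
have h0 z : 0 <= h z by rewrite mulr_ge0// mulr_ge0.
have mw : measurable_fun setT w.
  apply: (measurableT_comp (measurable_powR _)).
  by apply: measurable_funB => //; exact: measurable_cst.
have mk2 : measurable_fun setT (fun z : R * R => k (z.1 - z.2)).
  apply: (measurableT_comp (measurable_abel_kernel _)).
  by apply: measurable_funB.
have mh : measurable_fun setT h.
  apply: measurable_funM; first exact: measurableT_comp.
  by apply: measurable_funM => //; exact: measurableT_comp.
have mkT (s : R) : measurable_fun setT (fun t : R => k (s - t)).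
  apply: (measurableT_comp (measurable_abel_kernel _)).
  by apply: measurable_funB => //; exact: measurable_cst.
have mkT' (t : R) : measurable_fun setT (fun s : R => k (s - t)).
  apply: (measurableT_comp (measurable_abel_kernel _)).
  by apply: measurable_funB => //; exact: measurable_cst.
have [r rE] : exists r, abel_integral T = r%:E.
  exists (fine (abel_integral T)); rewrite fineK// ge0_fin_numE//.
  exact: abel_integral_ge0.
have r0 : 0 <= r by rewrite -lee_fin -rE abel_integral_ge0.
have M0 : 0 <= M.
  rewrite divr_ge0 ?(ltW p0)// subr_ge0 -[alpha - 1]opprB.
  by apply: ler_powRN; lra.
(* [A] is [int w U], [B] is [c int w(s) (T - s)], and [E] below is the integral
   of [u] against the defect [err]. *)
pose A := (\int[mu]_(s in `[S0, T]) \int[mu]_(t in `[0%R, T]) (h (s, t))%:E)%E.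
set B := (X in (X <= _)%E).
have AE : (A = \int[mu]_(s in `[S0, T]) ((w s)%:E * abel_integral s))%E.
  apply: eq_integral => s _; rewrite /abel_integral -ge0_integralZl_EFin//.
  - by move=> t _; rewrite lee_fin mulr_ge0.
  - by apply/measurable_EFinP; apply: measurable_funTS; exact: measurable_funM (mkT s) mu_.
have A0 : (0 <= A)%E.
  by apply: integral_ge0 => s _; apply: integral_ge0 => t _; rewrite lee_fin.
have mB : measurable_fun setT (fun s : R => w s * (c * (T - s))).
  apply: measurable_funM => //; apply: measurable_funM => //.
  by apply: measurable_funB => //; exact: measurable_cst.
have ABle : (A + B <= (M * r)%:E)%E.
  rewrite /M mulrC EFinM -integral_shifted_power// -ge0_integralZl_EFin//; last 2 first.
  - by move=> s _; rewrite lee_fin; exact: w0.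
  - by apply/measurable_EFinP; exact: measurable_funTS.
  rewrite -ge0_integralD//; last 4 first.
  - by move=> s _; apply: integral_ge0 => t _; rewrite lee_fin.
  - by apply: measurable_funTS; exact: measurable_partial_integral.
  - move=> s; rewrite /= in_itv/= => /andP[s1 s2].
    rewrite lee_fin mulr_ge0 ?powR_ge0// mulr_ge0//; lra.
  - by apply/measurable_EFinP; exact: measurable_funTS.
  apply: ge0_le_integral => //.
  - move=> s; rewrite /= in_itv/= => /andP[s1 s2]; apply: adde_ge0.
      by apply: integral_ge0 => t _; rewrite lee_fin.
    rewrite lee_fin mulr_ge0 ?powR_ge0// mulr_ge0//; lra.
  - apply: emeasurable_funD.
      by apply: measurable_funTS; exact: measurable_partial_integral.
    by apply/measurable_EFinP; exact: measurable_funTS.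
  - apply/measurable_EFinP; apply: measurable_funTS; apply: measurable_funM => //.
  - move=> s sI.
    have -> : (\int[mu]_(t in `[0%R, T]) (h (s, t))%:E =
        (w s)%:E * abel_integral s)%E.
      rewrite /abel_integral -ge0_integralZl_EFin//.
      + by move=> t _; rewrite lee_fin mulr_ge0.
      + by apply/measurable_EFinP; apply: measurable_funTS; exact: measurable_funM (mkT s) mu_.
    rewrite EFinM -ge0_muleDr ?abel_integral_ge0//; last first.
      move: sI; rewrite /= in_itv/= => /andP[s1 s2].
      by rewrite lee_fin mulr_ge0//; lra.
    rewrite [leRHS]muleC; apply: lee_wpmul2l; first by rewrite lee_fin.
    by rewrite -rE; exact: Uinc.
have mG : measurable_fun setT (fun t => (\int[mu]_(s in `[S0, T]) (h (s, t))%:E)%E).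
  apply: (@measurable_partial_integral R `[S0, T] (fun z => h (z.2, z.1))) => //.
  by apply: (measurableT_comp mh); exact: measurable_swap.
have err0 t : t \in `[S0, T] -> 0 <= err t.
  rewrite in_itv/= => /andP[t1 t2].
  by rewrite mulr_ge0 ?invr_ge0 ?(ltW p0)// mulr_ge0 ?powR_ge0// divr_ge0 ?powR_ge0//; lra.
have merr : measurable_fun `[S0, T] err.
  apply: (@measurable_fun_itv_cc _ _ _ false true).
  apply: open_continuous_measurable_fun => // x /set_mem.
  rewrite /= in_itv/= => /andP[x1 x2]; apply: cvgMl_tmp; apply: cvgM.
    apply: cvg_powR_gt0; first by rewrite subr_gt0.
    exact: cvg_subr_r.
  apply: cvgMl_tmp; apply: cvgV; last by apply: cvg_subr_r; exact: cvg_id.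
  by rewrite gt_eqF; lra.
pose uerr t := u t * err t.
have muerr : measurable_fun `[S0, T] uerr.
  by apply: measurable_funM => //; exact: measurable_funTS.
have uerr0 t : t \in `[S0, T] -> 0 <= uerr t by move=> tI; rewrite mulr_ge0 ?err0.
pose E := (\int[mu]_(t in `[S0, T]) (uerr t)%:E)%E.
have lower : ((M * r)%:E <= A + E)%E.
  have -> : A = (\int[mu]_(t in `[0%R, T]) \int[mu]_(s in `[S0, T]) (h (s, t))%:E)%E.
    exact: tonelli_set.
  have -> : E = (\int[mu]_(t in `[0%R, T]) ((uerr \_ `[S0, T]) t)%:E)%E.
    have DE : `[0, T]%classic `&` `[S0, T] = `[S0, T]%classic.
      by apply: setIidr; apply: subset_itvr; rewrite bnd_simp.
    rewrite /E -{1}DE (@integral_mkcondr _ _ _ mu _ _ (EFin \o uerr)).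
    by rewrite restrict_EFin.
  have mr : measurable_fun `[0%R, T] (EFin \o (uerr \_ `[S0, T])).
    apply/measurable_EFinP; apply: measurable_funTS.
    exact/(measurable_restrictT _ _).1.
  rewrite EFinM -rE /abel_integral -ge0_integralZl_EFin//; last 2 first.
  - by move=> t _; rewrite lee_fin mulr_ge0.
  - by apply/measurable_EFinP; apply: measurable_funTS; exact: measurable_funM (mkT T) mu_.
  rewrite -ge0_integralD//; last 3 first.
  - by move=> t _; apply: integral_ge0 => s _; rewrite lee_fin.
  - exact: measurable_funTS.
  - move=> t _; rewrite lee_fin patchE; case: ifPn => // /set_mem; exact: uerr0.
  apply: ge0_le_integral => //.
  - move=> t _; by rewrite -EFinM lee_fin mulr_ge0// mulr_ge0.
  - apply: measurable_funeM; apply/measurable_EFinP; apply: measurable_funTS.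
    exact: measurable_funM (mkT T) mu_.
  - by apply: emeasurable_funD; [exact: measurable_funTS|exact: mr].
  - move=> t _.
    have -> : (\int[mu]_(s in `[S0, T]) (h (s, t))%:E =
       (u t)%:E * \int[mu]_(s in `[S0, T]) (w s * k (s - t))%:E)%E.
      rewrite -ge0_integralZl_EFin//.
      + by apply: eq_integral => s _; rewrite -EFinM /h/=; congr EFin; ring.
      + by move=> s _; rewrite lee_fin mulr_ge0.
      + by apply/measurable_EFinP; apply: measurable_funTS; exact: measurable_funM mw (mkT' t).
    have -> : (((uerr \_ `[S0, T]) t)%:E = (u t)%:E * ((err \_ `[S0, T]) t)%:E)%E.
      by rewrite -EFinM !patchE; case: ifPn => //; rewrite mulr0.
    rewrite -ge0_muleDr; last 2 first.
    - by apply: integral_ge0 => s _; rewrite lee_fin mulr_ge0.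
    - rewrite lee_fin patchE; case: ifPn => // /set_mem; exact: err0.
    rewrite -EFinM mulrA mulrC EFinM; apply: lee_wpmul2l; first by rewrite lee_fin.
    exact: abel_kernel_average_ge.
have BE : (B <= E)%E.
  have B0 : (0 <= B)%E.
    apply: integral_ge0 => s; rewrite /= in_itv/= => /andP[s1 s2].
    by rewrite lee_fin mulr_ge0 ?powR_ge0// mulr_ge0//; lra.
  rewrite -(@leeD2lE _ A); first exact: le_trans ABle lower.
  rewrite ge0_fin_numE//; apply: (@le_lt_trans _ _ (M * r)%:E); last exact: ltry.
  by apply: le_trans ABle; rewrite leeDl.
apply: (le_trans BE).
pose g1 t := (T - t) `^ (- alpha) * ((q - T) `^ alpha / (q - t)).
pose g2 t := (T - t) `^ (- alpha).
pose K1 := (1 - alpha)^-1 * eps.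
pose K2 := (1 - alpha)^-1 * (C * (q - T) `^ alpha).
have K10 : 0 <= K1 by rewrite mulr_ge0 ?invr_ge0 ?(ltW p0).
have K20 : 0 <= K2 by rewrite !mulr_ge0 ?invr_ge0 ?powR_ge0 ?(ltW p0).
have g10 t : t \in `[S0, T] -> 0 <= g1 t.
  rewrite in_itv/= => /andP[t1 t2].
  by rewrite mulr_ge0 ?powR_ge0// divr_ge0 ?powR_ge0//; lra.
have g20 t : 0 <= g2 t by exact: powR_ge0.
have mg1 : measurable_fun `[S0, T] g1.
  have -> : g1 = (fun t => (1 - alpha) * err t).
    by apply/funext => t; rewrite /err [RHS]mulrA mulfV ?mul1r ?gt_eqF.
  by apply: measurable_funM => //; exact: measurable_cst.
have mg2 : measurable_fun `[S0, T] g2.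
  apply: measurable_funTS; apply: (measurableT_comp (measurable_powR _)).
  by apply: measurable_funB => //; exact: measurable_cst.
apply: (@le_trans _ _ (\int[mu]_(t in `[S0, T])
    (K1%:E * (g1 t)%:E + K2%:E * (g2 t)%:E))%E).
  apply: ge0_le_integral => //.
  - exact/measurable_EFinP.
  - apply: emeasurable_funD; apply: measurable_funeM; exact/measurable_EFinP.
  - move=> t tI; rewrite -!EFinM -EFinD lee_fin /uerr.
    apply: (@le_trans _ _ ((eps + C * (T - t)) * err t)).
      by rewrite ler_wpM2r ?err0// uC.
    rewrite mulrDl; apply: lerD.
      by rewrite /err /K1 /g1 mulrCA mulrA.
    have -> : C * (T - t) * err t = K2 * g2 t * ((T - t) / (q - t)).
      by rewrite /K2 /err /g2; ring.
    move: tI; rewrite /= in_itv/= => /andP[t1 t2].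
    apply: ler_piMr; first by rewrite mulr_ge0.
    by rewrite ler_pdivrMr; lra.
rewrite ge0_integralD//; last 4 first.
- by move=> t tI; rewrite lee_fin mulr_ge0// g10.
- by apply: measurable_funeM; exact/measurable_EFinP.
- by move=> t tI; rewrite lee_fin mulr_ge0// g10.
- by apply: measurable_funeM; exact/measurable_EFinP.
rewrite !ge0_integralZl_EFin//; last 3 first.
- by move=> t _; rewrite lee_fin.
- exact/measurable_EFinP.
- exact/measurable_EFinP.
rewrite integral_abel_kernel// -EFinM mulrDr EFinD; apply: leeD; last first.
  by rewrite lee_fin /K2 !mulrA.
apply: (@le_trans _ _ (K1%:E * (alpha^-1 + (1 - alpha)^-1)%:E)%E); last first.
  by rewrite -EFinM lee_fin /K1 mulrA.
apply: lee_wpmul2l; first by rewrite lee_fin.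
exact: integral_approx_identity_le.
Qed.

End Averaging.

(** * Abel transforms cannot leave a zero linearly *)

Section Contact.
Context {R : realType}.
Notation mu := (@lebesgue_measure R).
Implicit Types (alpha T : R) (u : R -> R).

Lemma abel_integrand_integrable alpha u (s : R) :
  0 < alpha -> alpha < 1 -> continuous u -> 0 < s ->
  mu.-integrable `[0, s] (fun t => ((s - t) `^ (- alpha) * u t)%:E).
Proof.
move=> a0 a1 cu s0.
have mk : measurable_fun setT (fun t : R => (s - t) `^ (- alpha)).
  apply: (measurableT_comp (measurable_powR _)).
  by apply: measurable_funB => //; exact: measurable_cst.
have ik : mu.-integrable `[0, s] (fun t => ((s - t) `^ (- alpha))%:E).
  apply/integrableP; split; first by apply/measurable_EFinP; exact: measurable_funTS.
  under eq_integral do rewrite /= ger0_norm ?powR_ge0//.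
  by rewrite integral_abel_kernel// ltry.
have cau : {within `[0, s], continuous (fun t => `|u t|)}.
  apply: continuous_subspaceT => x; apply: continuous_comp; first exact: cu.
  exact: norm_continuous.
have [m mI Vu] := EVT_max (ltW s0) cau.
have iVk : mu.-integrable `[0, s] (fun t => (`|u m|%:E * ((s - t) `^ (- alpha))%:E)%E).
  exact: integrableZl.
apply: le_integrable iVk => //.
- apply/measurable_EFinP; apply: measurable_funTS; apply: measurable_funM => //.
  exact: continuous_measurable_fun.
- move=> t tI; rewrite -EFinM !abse_EFin lee_fin !normrM normr_id mulrC.
  by rewrite ler_wpM2r// Vu.
Qed.

Definition abel_transform alpha u (s : R) : R :=
  \int[mu]_(t in `[0, s]) ((s - t) `^ (- alpha) * u t).

Lemma abel_integralE alpha T u (s : R) :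
  0 < alpha -> alpha < 1 -> continuous u -> 0 < s <= T ->
  abel_integral alpha T u s = (abel_transform alpha u s)%:E.
Proof.
move=> a0 a1 cu /andP[s0 sT]; rewrite /abel_transform /Rintegral fineK; last first.
  exact: integrable_fin_num (abel_integrand_integrable a0 a1 cu s0).
have sub : `[0, T]%classic `&` `[0, s] = `[0, s]%classic.
  by apply: setIidr; apply: subset_itvl; rewrite bnd_simp.
rewrite -[X in (_ = \int[_]_(_ in X) _)%E]sub integral_mkcondr.
apply: eq_integral => t /set_mem; rewrite /= in_itv/= => /andP[t0 tT].
rewrite patchE; case: ifPn => [/set_mem|/negP ts].
  by rewrite /= in_itv/= => /andP[_ ts]; rewrite abel_kernelE// subr_ge0.
rewrite abel_kernel_le0 ?mul0r// subr_le0 leNgt; apply/negP => ts'.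
by apply: ts; apply/mem_set; rewrite /= in_itv/= t0 ltW.
Qed.

Lemma integral_linear (a b : R) : a < b ->
  (\int[mu]_(s in `[a, b]) (b - s)%:E)%E = ((b - a) ^+ 2 / 2)%:E.
Proof.
move=> ab; pose F s := - ((b - s) ^+ 2 / 2).
transitivity ((F b - F a)%:E); last by congr EFin; rewrite /F; field.
have dF (x : R) : is_derive x 1 F (b - x).
  apply: is_derive_eq; rewrite /GRing.scale/=; by field.
have cF : continuous F.
  by move=> y; apply/differentiable_continuous/derivable1_diffP; have [] := dF y.
apply: (ge0_improper_FTC2 ab) => //.
- by move=> x; rewrite in_itv/= => /andP[x1 x2]; lra.
- by move=> x _; apply: cvg_subr_r; exact: cvg_id.
- by apply: cvg_at_right_filter; exact: cF.
- by apply: cvg_at_left_filter; exact: cF.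
Qed.

(** A modulus of continuity at a zero, in a form that can be integrated: within
    the radius [d] given by continuity use [eps], beyond it the slope
    [max u / d]. *)
Lemma continuous_affine_majorant u T eps : continuous u -> (forall t, 0 <= u t) ->
  0 < T -> u T = 0 -> 0 < eps ->
  exists2 C, 0 <= C & forall t, t \in `[0, T] -> u t <= eps + C * (T - t).
Proof.
move=> cu u0 T0 uT eps0.
have [m mI Vu] := EVT_max (ltW T0) (continuous_subspaceT cu).
have /cvgrPdist_lt/(_ _ eps0)[d /= d0 ud] := cu T.
exists (u m / d); first by rewrite divr_ge0// ltW.
move=> t tI; have tT : 0 <= T - t by move: tI; rewrite in_itv/= => /andP[]; lra.
have [td|td] := ltP (T - t) d.
  have := ud t; rewrite /ball/= ger0_norm// uT sub0r normrN ger0_norm// => /(_ td) uteps.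
  by rewrite (le_trans (ltW uteps))// lerDl mulr_ge0// divr_ge0// ltW.
apply: (le_trans (Vu t tI)); rewrite -[leLHS]add0r; apply: lerD; first exact: ltW.
by rewrite -mulrA ler_peMr// mulrC ler_pdivlMr ?mul1r.
Qed.

(** Letting [q] tend to [T] in [averaged_increment_le], the right-hand side can
    be made smaller than any fixed positive number, whereas the left-hand side is
    at least [kappa], the value obtained by bounding the weight below on
    [[S0, T]] for [q - T <= T - S0]. *)
Lemma abel_no_linear_contact alpha T (S0 c : R) u :
  0 < alpha -> alpha < 1 -> continuous u -> (forall t, 0 <= u t) ->
  0 < S0 -> S0 < T -> u T = 0 -> 0 < c ->
  (forall s, s \in `[S0, T] -> abel_transform alpha u s + c * (T - s) <= abel_transform alpha u T) ->
  False.
Proof.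
move=> a0 a1 cu u0 S00 ST uT c0 inc.
have p0 : 0 < 1 - alpha by lra.
have T0 : 0 < T by lra.
pose H := T - S0; have H0 : 0 < H by rewrite subr_gt0.
pose kappa := (2 * H) `^ (alpha - 2) * c * (H ^+ 2 / 2).
have kappa0 : 0 < kappa.
  by rewrite !mulr_gt0 ?invr_gt0 ?powR_gt0 ?exprn_gt0 ?mulr_gt0.
pose Z := alpha^-1 + (1 - alpha)^-1.
have Z0 : 0 < Z by rewrite addr_gt0 ?invr_gt0.
pose Y := H `^ (1 - alpha) / (1 - alpha).
have Y0 : 0 <= Y by rewrite divr_ge0 ?powR_ge0 ?ltW.
(* [eps] makes the mass term equal to [kappa / 2], and [eta] makes the remaining
   term smaller than [kappa / 2]. *)
pose eps := kappa / 2 * (1 - alpha) / Z.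
have eps0 : 0 < eps by rewrite divr_gt0// mulr_gt0// divr_gt0.
have [C C0 uC] := continuous_affine_majorant cu u0 T0 uT eps0.
have CY0 : 0 <= C * Y by rewrite mulr_ge0.
pose delta := kappa / 2 * (1 - alpha) / (C * Y + 1).
have CY1 : 0 < C * Y + 1 by lra.
have delta0 : 0 < delta by rewrite divr_gt0// mulr_gt0// divr_gt0.
pose eta := Num.min H (delta `^ alpha^-1).
have eta0 : 0 < eta by rewrite lt_min H0 powR_gt0.
have etaH : eta <= H by rewrite ge_min lexx.
have etad : eta `^ alpha <= delta.
  have -> : delta = (delta `^ alpha^-1) `^ alpha.
    by rewrite -powRrM mulVf ?gt_eqF// powRr1// ltW.
  by apply: ge0_ler_powR; rewrite ?nnegrE ?powR_ge0 ?(ltW eta0) ?(ltW a0)// ge_min lexx orbT.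
have uT_fin : (abel_integral alpha T u T < +oo)%E.
  by rewrite abel_integralE// ?ltry// T0 lexx.
have := @averaged_increment_le R alpha T u u0 S0 (T + eta) c eps C a0 a1 cu
  (ltW S00) ST _ (ltW c0) (ltW eps0) C0 _ uT_fin _.
rewrite ltrDl => /(_ eta0).
have uC' t : t \in `[S0, T] -> u t <= eps + C * (T - t).
  by move=> tI; apply: uC; move: tI; rewrite !in_itv/= => /andP[t1 ->]; lra.
move=> /(_ uC').
have inc' s : s \in `[S0, T] ->
    (abel_integral alpha T u s + (c * (T - s))%:E <= abel_integral alpha T u T)%E.
  move=> sI; rewrite !abel_integralE//; last 2 first.
  - by rewrite T0 lexx.
  - by move: sI; rewrite in_itv/= => /andP[s1 ->]; rewrite (lt_le_trans S00).
  by rewrite -EFinD lee_fin inc.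
move=> /(_ inc').
rewrite addrAC subrr add0r -/H -/Y -/Z => upper.
suff lower : (kappa%:E <= \int[mu]_(s in `[S0, T])
    ((T + eta - s) `^ (alpha - 2) * (c * (T - s)))%:E)%E.
  have := le_trans lower upper; rewrite lee_fin mulrDr.
  have -> : (1 - alpha)^-1 * (eps * Z) = kappa / 2.
    by rewrite /eps; field; rewrite !gt_eqF.
  have : (1 - alpha)^-1 * (C * eta `^ alpha * Y) < kappa / 2.
    rewrite mulrC ltr_pdivrMr//.
    apply: (@le_lt_trans _ _ (C * Y * delta)).
      by rewrite mulrAC ler_wpM2l.
    have -> : kappa / 2 * (1 - alpha) = (C * Y + 1) * delta.
      by rewrite /delta; field; rewrite gt_eqF//; lra.
    by rewrite ltr_pM2r// ltrDl.
  lra.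
have mTs : measurable_fun setT (fun s : R => T - s).
  by apply: measurable_funB => //; exact: measurable_cst.
rewrite /kappa EFinM -integral_linear// -ge0_integralZl_EFin//; last 3 first.
- by move=> s; rewrite /= in_itv/= => /andP[s1 s2]; rewrite lee_fin subr_ge0.
- by apply/measurable_EFinP; exact: measurable_funTS.
- by rewrite mulr_ge0 ?powR_ge0// ltW.
apply: ge0_le_integral => //.
- move=> s; rewrite /= in_itv/= => /andP[s1 s2]; rewrite lee_fin !mulr_ge0 ?powR_ge0//.
    exact: ltW.
  by rewrite subr_ge0.
- apply: measurable_funeM; apply/measurable_EFinP; exact: measurable_funTS.
- apply/measurable_EFinP; apply: measurable_funTS; apply: measurable_funM.
    apply: (measurableT_comp (measurable_powR _)).
    by apply: measurable_funB => //; exact: measurable_cst.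
  by apply: measurable_funM.
- move=> s; rewrite /= in_itv/= => /andP[s1 s2]; rewrite -EFinM lee_fin -mulrA.
  have sT : 0 <= c * (T - s) by rewrite mulr_ge0 ?(ltW c0)// subr_ge0.
  rewrite ler_wpM2r// -[alpha - 2]opprB; apply: ler_powRN; rewrite /H in H0 etaH *; lra.
Qed.

End Contact.

(** * Positivity of the Gamma function *)

Section GammaPositive.
Context {R : realType}.
Notation mu := (@lebesgue_measure R).

Lemma integral_expRN : (\int[mu]_(s in `[0%R, +oo[) (expR (- s))%:E = 1)%E.
Proof.
have dF (x : R) : is_derive x 1 (fun s => - expR (- s)) (expR (- x)).
  apply: is_derive_eq; rewrite /GRing.scale/=; by ring.
have cE : continuous (fun s : R => expR (- s)).
  move=> x; apply: continuous_comp; last exact: continuous_expR.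
  exact: cvgN.
rewrite (@ge0_continuous_FTC2y _ _ (fun s => - expR (- s)) 0 0).
- by rewrite oppr0 expR0 sub0e -EFinN opprK.
- by move=> x _; exact: expR_ge0.
- exact: continuous_subspaceT.
- rewrite -oppr0; apply: cvgN; exact: cvgr_expR.
- by move=> x _; have [] := dF x.
- by apply: cvg_at_right_filter; apply: cvgN; exact: cE.
- by move=> x _; have [_ <-] := dF x; rewrite derive1E.
Qed.

(** Finiteness has to be shown too, since a real-valued integral is [0] when it
    diverges: the integrand is dominated by [s^(p-1)] on [[0, 1]] and by
    [exp (- s)] beyond [1]. *)
Lemma Gamma_gt0 (p : R) : 0 < p -> p < 1 -> 0 < Gamma p.
Proof.
move=> p0 p1.
pose g (s : R) := s `^ (p - 1) * expR (- s).
have g0 s : 0 <= g s by rewrite mulr_ge0 ?powR_ge0 ?expR_ge0.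
have mp : measurable_fun setT (fun s : R => s `^ (p - 1)) by exact: measurable_powR.
have me : measurable_fun setT (fun s : R => expR (- s)).
  exact: (measurableT_comp (@measurable_expR R)).
have mg : measurable_fun setT g by exact: measurable_funM.
have near0 : (\int[mu]_(s in `[0%R, 1%R]) (s `^ (p - 1))%:E = (p^-1)%:E)%E.
  pose F (s : R) := s `^ p / p.
  transitivity ((F 1 - F 0)%:E).
    apply: (ge0_improper_FTC2 ltr01).
    - move=> x; rewrite in_itv/= => /andP[x0 x1].
      have dx := @is_derive1_powR R p x x0.
      rewrite /F; apply: is_derive_eq; rewrite /GRing.scale/= mulr0 add0r.
      by rewrite mulrA mulVf ?mul1r// gt_eqF.
    - by move=> x _; exact: powR_ge0.
    - by move=> x; rewrite in_itv/= => /andP[x0 x1]; exact: powR_continuous_gt0.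
    - rewrite /F; apply: cvgMr_tmp; apply: cvg_powR_0 => //.
      + by near=> x.
      + by apply: cvg_at_right_filter; exact: cvg_id.
    - rewrite /F; apply: cvgMr_tmp; apply: cvg_powR_gt0 => //.
      by apply: cvg_at_left_filter; exact: cvg_id.
  by rewrite /F powR1 powR0 ?gt_eqF// mul0r subr0 mul1r.
have D01 : (`]0, 1]%classic : set R) `<=` `]0, +oo[.
  by apply: subset_itvl.
rewrite /Gamma /Rintegral -/g fine_gt0//; apply/andP; split.
  apply: (@lt_le_trans _ _ (\int[mu]_(s in `]0%R, 1%R]) (expR (- 1))%:E)%E).
    rewrite integral_cst//= lebesgue_measure_itv/= lte_fin ltr01 oppr0 adde0 mule1.
    by rewrite lte_fin expR_gt0.
  apply: (@le_trans _ _ (\int[mu]_(s in `]0%R, 1%R]) (g s)%:E)%E).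
    apply: ge0_le_integral => //.
    - by apply/measurable_EFinP; exact: measurable_funTS.
    - move=> s; rewrite /= in_itv/= => /andP[s0 s1]; rewrite lee_fin.
      rewrite -[leLHS]mul1r; apply: ler_pM; rewrite ?expR_ge0//.
        by rewrite -[leLHS](powRr0 s); apply: ger_powR; [rewrite s0|lra].
      by rewrite ler_expR lerN2.
  apply: ge0_subset_integral => //.
  - by apply/measurable_EFinP; exact: measurable_funTS.
  - by move=> s _; rewrite lee_fin.
apply: (@le_lt_trans _ _ (\int[mu]_(s in `]0%R, +oo[)
    (((fun s => s `^ (p - 1)) \_ `[0%R, 1%R]) s + expR (- s))%:E)%E).
  apply: ge0_le_integral => //.
  - by move=> s _; rewrite lee_fin; exact: g0.
  - by apply/measurable_EFinP; exact: measurable_funTS.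
  - apply/measurable_EFinP; apply: measurable_funTS; apply: measurable_funD => //.
    exact/(measurable_restrictT _ _).1/measurable_funTS.
  - move=> s; rewrite /= in_itv/= andbT => s0; rewrite lee_fin patchE.
    case: ifPn => [/set_mem|/negP s1].
      rewrite /= in_itv/= => /andP[_ s1]; apply: (@le_trans _ _ (s `^ (p - 1))).
        by rewrite ler_piMr ?powR_ge0// -expR0 ler_expR; lra.
      by rewrite lerDl expR_ge0.
    rewrite add0r ler_piMl ?expR_ge0//.
    have {}s1 : 1 <= s.
      rewrite leNgt; apply/negP => s1'; apply: s1; apply/mem_set.
      by rewrite /= in_itv/= !ltW.
    by rewrite -[leRHS](powRr0 s); apply: ler_powR => //; lra.
under eq_integral do rewrite EFinD.
rewrite ge0_integralD//; last 3 first.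
- by move=> s _; rewrite lee_fin patchE; case: ifPn => // _; exact: powR_ge0.
- apply/measurable_EFinP; apply: measurable_funTS.
  exact/(measurable_restrictT _ _).1/measurable_funTS.
- by apply/measurable_EFinP; exact: measurable_funTS.
apply: (@le_lt_trans _ _ ((p^-1)%:E + 1)%E); last by rewrite -EFinD ltry.
apply: leeD.
  rewrite -near0.
  have -> : (\int[mu]_(x in `]0%R, +oo[) (((powR (R:=R))^~ (p - 1) \_ `[0%R, 1%R]) x)%:E =
     \int[mu]_(x in `]0%R, +oo[ `&` `[0%R, 1%R]) (x `^ (p - 1))%:E)%E.
    by rewrite integral_mkcondr; apply: eq_integral => s _; rewrite !patchE; case: ifP.
  apply: ge0_subset_integral => //.
  - exact: measurableI.
  - by apply/measurable_EFinP; exact: measurable_funTS.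
  - by move=> s _; rewrite lee_fin powR_ge0.
rewrite -integral_expRN; apply: ge0_subset_integral => //.
- by apply/measurable_EFinP; exact: measurable_funTS.
- by apply: subset_itvr; rewrite bnd_simp.
Unshelve. all: end_near. Qed.

End GammaPositive.

(** * Two functions with equal Caputo derivatives at their first meeting *)

Section FirstMeeting.
Context {R : realType}.
Notation mu := (@lebesgue_measure R).

Lemma first_zero (D : R -> R) (t0 : R) : continuous D -> 0 <= t0 ->
  D 0 != 0 -> D t0 = 0 ->
  exists T, [/\ 0 < T, T <= t0, D T = 0 & forall t, 0 <= t < T -> D t != 0].
Proof.
move=> cD t00 D0 Dt0.
pose Z := `[0, t0]%classic `&` D @^-1` [set 0].
have cZ : compact Z.
  apply: (subclosed_compact _ (@segment_compact _ 0 t0)); last by move=> x [].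
  apply: closedI; first exact: interval_closed.
  by apply: preimage_closed => // *; exact: cD.
have Z0 : Z !=set0 by exists t0; split => //=; rewrite in_itv/= t00 lexx.
have [|T TZ Tmin] := @compact_EVT_min _ R id Z Z0 cZ.
  by apply: continuous_subspaceT => x; exact: cvg_id.
move: TZ => /set_mem[]; rewrite /= in_itv/= => /andP[T0 Tt0] DT.
exists T; split => //.
  by rewrite lt_neqAle T0 andbT; apply/eqP => T0'; move: D0; rewrite [X in D X]T0' DT eqxx.
move=> t /andP[tge tT]; apply/negP => /eqP Dt.
have tZ : t \in Z.
  by apply/mem_set; split => //=; rewrite in_itv/= tge (le_trans (ltW tT)).
by have := Tmin t tZ; rewrite leNgt tT.
Qed.

(** The functions [J1] and [J2] are identified with fractional integrals of [x1]
    and [x2] up to time [T] only: [x1] and [x2] will be globally continuous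
    modifications of solutions, whereas the derivatives at [T] involve the
    fractional integrals of the solutions themselves past [T]. *)
Lemma no_first_meeting (alpha T : R) (x1 x2 J1 J2 : R -> R) :
  0 < alpha -> alpha < 1 -> 0 < T ->
  continuous x1 -> continuous x2 ->
  (forall t, x2 t <= x1 t) -> x2 0 < x1 0 -> x1 T = x2 T ->
  (forall t, 0 < t <= T -> J1 t = RLintegral (1 - alpha) (fun s => x1 s - x1 0) t) ->
  (forall t, 0 < t <= T -> J2 t = RLintegral (1 - alpha) (fun s => x2 s - x2 0) t) ->
  derivable J1 T 1 -> derivable J2 T 1 -> derive1 J1 T = derive1 J2 T ->
  False.
Proof.
move=> a0 a1 T0 cx1 cx2 x21 x0 xT J1E J2E dJ1 dJ2 dJE.
have p0 : 0 < 1 - alpha by lra.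
have G0 := Gamma_gt0 p0 _.
pose G := Gamma (1 - alpha).
have {}G0 : 0 < G by apply: G0; lra.
pose u t := x1 t - x2 t.
have cu : continuous u by move=> t; apply: cvgB; [exact: cx1|exact: cx2].
have u0 t : 0 <= u t by rewrite subr_ge0.
have uT : u T = 0 by rewrite /u xT subrr.
pose d0 := u 0; have d00 : 0 < d0 by rewrite subr_gt0.
pose P t := t `^ (1 - alpha) / (1 - alpha).
(* [N] is differentiable at [T] by assumption and coincides up to [T] with the
   Abel transform of [u], the second summand restoring the initial value
   [u 0] that the Caputo derivative subtracts. *)
pose N t := G * (J1 t - J2 t) + d0 * P t.
have NE t : 0 < t <= T -> N t = abel_transform alpha u t.
  move=> tI; have /andP[t0 tT] := tI.
  rewrite /N J1E// J2E// /RLintegral -/G -mulrBr mulrA mulfV ?mul1r ?gt_eqF//.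
  rewrite (_ : 1 - alpha - 1 = - alpha); last by ring.
  have cB (x : R -> R) : continuous x -> continuous (fun s => x s - x 0).
    by move=> cx s; apply: cvgB; [exact: cx|exact: cvg_cst].
  have i1 := abel_integrand_integrable a0 a1 (cB _ cx1) t0.
  have i2 := abel_integrand_integrable a0 a1 (cB _ cx2) t0.
  have i3 : mu.-integrable `[0, t] (fun s => ((t - s) `^ (- alpha) * 1)%:E).
    apply: (@abel_integrand_integrable _ _ (cst 1)) => //; exact: cst_continuous.
  have i4 := abel_integrand_integrable a0 a1 cu t0.
  rewrite -RintegralB//.
  have -> : P t = \int[mu]_(s in `[0, t]) ((t - s) `^ (- alpha) * 1).
    rewrite /Rintegral; under eq_integral do rewrite mulr1.
    by rewrite integral_abel_kernel// subr0.
  rewrite -RintegralZl// -RintegralD//.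
  - by apply: eq_Rintegral => s _; rewrite /u /d0 /u; ring.
  - by apply: (integrableB _ i1 i2).
  - by apply: (integrableZl _ d0 i3).
have dP : is_derive T 1 P (T `^ (- alpha)).
  have dT := @is_derive1_powR R (1 - alpha) T T0.
  rewrite /P; apply: is_derive_eq; rewrite /GRing.scale/= mulr0 add0r.
  by rewrite (_ : 1 - alpha - 1 = - alpha); [field; lra|ring].
have dN : is_derive T 1 N (d0 * T `^ (- alpha)).
  have dJ1' := derivableP dJ1; have dJ2' := derivableP dJ2.
  rewrite /N; apply: is_derive_eq.
  by rewrite !derive1E in dJE; rewrite dJE subrr /GRing.scale/= !mulr0 !add0r.
pose c := d0 * T `^ (- alpha) / 2.
have c0 : 0 < c by rewrite divr_gt0// mulr_gt0// powR_gt0.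
have [e e0 Ne] : exists2 e, 0 < e & forall s, 0 < T - s < e -> N s + c * (T - s) <= N T.
  have [dN1 dN2] := dN.
  have := dN1; rewrite /derivable -/(derive N T 1) => dNc.
  have : h^-1 *: (N (h *: 1 + T) - N T) @[h --> 0^'] --> d0 * T `^ (- alpha).
    by rewrite -dN2; exact: dNc.
  move/cvgrPdist_lt => /(_ _ c0)[e /= e0 He].
  exists e => // s /andP[s0 se].
  have := He (s - T); rewrite /ball/= sub0r normrN ltr0_norm ?opprB; last by lra.
  have sT : s - T != 0 by lra.
  move=> /(_ se sT); rewrite /GRing.scale/= mulr1 subrK => Hs.
  have {Hs} : c < (s - T)^-1 * (N s - N T).
    by move: Hs; rewrite ltr_norml => /andP[_]; rewrite /c; lra.
  rewrite mulrC ltr_ndivlMr; lra.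
(* Close enough to [T] for the increment bound, and positive. *)
pose S0 := Num.max (T - e / 2) (T / 2).
have S00 : 0 < S0 by rewrite lt_max; apply/orP; right; lra.
have ST : S0 < T by rewrite gt_max; apply/andP; split; lra.
have Se : T - S0 < e by rewrite ltrBlDl -ltrBlDr lt_max; apply/orP; left; lra.
apply: (abel_no_linear_contact a0 a1 cu u0 S00 ST uT c0).
move=> s; rewrite in_itv/= => /andP[s1 s2].
rewrite -!NE; [|by apply/andP; split; lra|by apply/andP; split; lra].
have [->|sT] := eqVneq s T; first by rewrite subrr mulr0 addr0.
by apply: Ne; rewrite subr_gt0 lt_neqAle sT s2/=; lra.
Qed.

End FirstMeeting.

Section FirstMeetingOnSegment.
Context {R : realType}.
Implicit Types (phi : R -> R).

Definition clamp (T t : R) : R := Num.max 0 (Num.min t T).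

Lemma clamp_in (T t : R) : 0 <= T -> clamp T t \in `[0, T].
Proof. by move=> T0; rewrite in_itv/= le_max lexx ge_max T0 ge_min lexx orbT. Qed.

Lemma clamp_id (T t : R) : t \in `[0, T] -> clamp T t = t.
Proof. by rewrite in_itv/= => /andP[t0 tT]; rewrite /clamp min_l// max_r. Qed.

Lemma continuous_clamp phi (T : R) : 0 <= T ->
  {within `[0, T], continuous phi} -> continuous (phi \o clamp T).
Proof.
move=> T0 /subspace_continuousP cphi t.
have clT : clamp T x @[x --> t] --> clamp T t.
  apply: (@continuous_max _ _ (cst 0) (fun s => Num.min s T)).
    exact: cst_continuous.
  apply: (@continuous_min _ _ id (cst T)); first exact: cvg_id.
  exact: cst_continuous.
have cl : clamp T x @[x --> t] --> within `[0, T] (nbhs (clamp T t)).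
  move=> P; rewrite /within/= => HP; change (\forall x \near t, P (clamp T x)).
  have HP' : \forall x \near t, `[0, T]%classic (clamp T x) -> P (clamp T x).
    exact: (clT _ HP).
  by near=> x; apply: (near HP' x) => //; exact: clamp_in.
by move=> P /(cphi _ (clamp_in t T0)) /cl.
Unshelve. all: end_near. Qed.

(** By the intermediate value theorem [phi1 - phi2] keeps its sign before [T].
    Freezing both functions outside [[0, T]] makes this ordering and continuity
    global without changing the fractional integrals up to time [T]. *)
Lemma caputo_first_meeting (alpha T : R) phi1 phi2 :
  0 < alpha -> alpha < 1 -> 0 < T ->
  {within `[0, T], continuous phi1} -> {within `[0, T], continuous phi2} ->
  phi2 0 < phi1 0 -> phi1 T = phi2 T ->
  (forall t, 0 <= t < T -> phi1 t != phi2 t) ->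
  Caputo_derivable alpha phi1 T -> Caputo_derivable alpha phi2 T ->
  Caputo alpha phi1 T <> Caputo alpha phi2 T.
Proof.
move=> a0 a1 T0 c1 c2 d0 dT dneq cd1 cd2 cE.
have T0' := ltW T0.
pose z1 := phi1 \o clamp T; pose z2 := phi2 \o clamp T.
have cz1 : continuous z1 by exact: continuous_clamp.
have cz2 : continuous z2 by exact: continuous_clamp.
have cl0 : clamp T 0 = 0 by rewrite clamp_id// in_itv/= lexx.
have clT : clamp T T = T by rewrite clamp_id// in_itv/= lexx andbT.
have ordered t : 0 <= t <= T -> phi2 t <= phi1 t.
  move=> /andP[t0 tT]; rewrite leNgt; apply/negP => lt12.
  have cD : {within `[0, t], continuous (fun s => z1 s - z2 s)}.
    by apply: continuous_subspaceT => s; apply: cvgB; [exact: cz1|exact: cz2].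
  have Dt : z1 t - z2 t < 0.
    by rewrite /z1 /z2/= clamp_id ?in_itv/= ?t0// subr_lt0.
  have D0 : 0 < z1 0 - z2 0 by rewrite /z1 /z2/= cl0 subr_gt0.
  have [|s] := @IVT _ _ _ _ 0 t0 cD.
    by rewrite ge_min le_max (ltW Dt) (ltW D0) orbT.
  rewrite in_itv/= => /andP[s0 st]; have sT := le_trans st tT.
  rewrite /z1 /z2/= clamp_id ?in_itv/= ?s0// => /eqP; rewrite subr_eq0 => /eqP s12.
  have sneq : s != t by apply/eqP => sE; move: lt12; rewrite -sE s12 ltxx.
  have sI : 0 <= s < T by rewrite s0 (lt_le_trans _ tT)// lt_neqAle sneq.
  by have := dneq s sI; rewrite s12 eqxx.
have RLE phi t : 0 < t <= T -> RLintegral (1 - alpha) (fun s => phi s - phi 0) t =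
    RLintegral (1 - alpha) (fun s => (phi \o clamp T) s - (phi \o clamp T) 0) t.
  move=> /andP[t0 tT]; rewrite /RLintegral; congr (_ * _).
  apply: eq_Rintegral => s /set_mem; rewrite /= in_itv/= => /andP[s0 st].
  by rewrite cl0 clamp_id// in_itv/= s0 (le_trans st).
apply: (@no_first_meeting _ alpha T z1 z2 _ _ a0 a1 T0 cz1 cz2 _ _ _
  (RLE phi1) (RLE phi2) cd1 cd2 cE).
- by move=> t; apply: ordered; have := clamp_in t T0'; rewrite in_itv.
- by rewrite /z1 /z2/= cl0.
- by rewrite /z1 /z2/= clT.
Qed.

End FirstMeetingOnSegment.

Theorem theorem33 (R : realType) (alpha : R) (halpha0 : 0 < alpha)
    (halpha1 : alpha < 1) (a b : \bar R) (hab : (a < b)%E)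
    (f : R -> R -> R) (hf : continuous_field a b f)
    (hlip : locally_lipschitz_field a b f)
    (x1 x2 : R) (hx1 : oointerval a b x1) (hx2 : oointerval a b x2)
    (hx12 : x1 <> x2)
    (T1 T2 : \bar R) (phi1 phi2 : R -> R)
    (hphi1 : is_maximal_solution alpha a b f x1 T1 phi1)
    (hphi2 : is_maximal_solution alpha a b f x2 T2 phi2) :
  forall t : R, timespan T1 t -> timespan T2 t -> phi1 t <> phi2 t.
Proof.
move=> t0 [t00 tT1] [_ tT2] meet.
have [[_ i1 c1 _ eq1] _] := hphi1.
have [[_ i2 c2 _ eq2] _] := hphi2.
have sub (T' : \bar R) (s : R) : s <= t0 -> (t0%:E < T')%E -> `[0, s] `<=` timespan T'.
  move=> st tT' r; rewrite /= in_itv/= => /andP[r0 rs]; split => //.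
  by apply: le_lt_trans tT'; rewrite lee_fin (le_trans rs).
have c01 (s : R) : s <= t0 -> {within `[0, s], continuous phi1}.
  by move=> st; apply: continuous_subspaceW c1; exact: sub.
have c02 (s : R) : s <= t0 -> {within `[0, s], continuous phi2}.
  by move=> st; apply: continuous_subspaceW c2; exact: sub.
pose D t := (phi1 \o clamp t0) t - (phi2 \o clamp t0) t.
have DE t : 0 <= t <= t0 -> D t = phi1 t - phi2 t.
  by move=> tI; rewrite /D/= clamp_id// in_itv.
have cD : continuous D.
  by move=> t; apply: cvgB; apply: continuous_clamp => //; [exact: c01|exact: c02].
have [||T [T0 Tt0 DT Dneq]] := first_zero cD t00.
- by rewrite DE ?lexx// i1 i2 subr_eq0; exact/eqP.
- by rewrite DE ?lexx ?t00// meet subrr.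
have meetT : phi1 T = phi2 T.
  by apply/eqP; rewrite -subr_eq0 -DE ?DT// (ltW T0).
have neqT t : 0 <= t < T -> phi1 t != phi2 t.
  move=> tI; have := Dneq t tI; rewrite DE ?subr_eq0//.
  by case/andP: tI => -> /ltW/le_trans; apply.
have [d1 e1] : Caputo_derivable alpha phi1 T /\ Caputo alpha phi1 T = f T (phi1 T).
  by apply: eq1 => //; apply: (sub _ T) => //=; rewrite in_itv/= lexx (ltW T0).
have [d2 e2] : Caputo_derivable alpha phi2 T /\ Caputo alpha phi2 T = f T (phi2 T).
  by apply: eq2 => //; apply: (sub _ T) => //=; rewrite in_itv/= lexx (ltW T0).
have [x12|x21|] := ltgtP x1 x2; last by [].
- apply: (@caputo_first_meeting _ alpha T phi2 phi1) => //.
  + exact: c02.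
  + exact: c01.
  + by rewrite i1 i2.
  + by move=> t tI; rewrite eq_sym neqT.
  + by rewrite e1 e2 meetT.
- apply: (@caputo_first_meeting _ alpha T phi1 phi2) => //.
  + exact: c01.
  + exact: c02.
  + by rewrite i1 i2.
  + by rewrite e1 e2 meetT.
Qed.
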